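(* Let $m,n\in\mathbb{N}$ with $m<n$. Then every finitely generated subsemigroup of the Baumslag--Solitar semigroup $\mathrm{S}(m,n)$ is left-automatic.
   Context: $\mathbb{N}$ denotes the set of positive integers. For $m,n\in\mathbb{N}$, the Baumslag--Solitar semigroup $\mathrm{S}(m,n)$ is the semigroup defined by the semigroup presentation with generators $x,y$ and the single defining relation $yx^m=x^ny$. Elements are represented by words over $\{x,y\}$. The empty word is not included in the presented semigroup. For an alphabet $A$, $A^+$ is the set of nonempty words over $A$ and $\varepsilon$ is the empty word. If $A$ is an alphabet representing a set of generators for a semigroup $S$, then for $w\in A^+$, $\overline{w}$ denotes the element of $S$ represented by $w$, and $\overline{W}=\{\overline{w}: w\in W\}$ for $W\subseteq A^+$. Let $\$$ be a symbol not in $A$ and let $A(2,\$)=\{(a,b): a,b\in A\cup\{\$\}\}\setminus\{(\$,\$)\}$, regarded as an alphabet. The map $\delta_A: A^+\times A^+\to A(2,\$)^+$ (written on the right) sends $(u_1\cdots u_p,\,v_1\cdots v_q)$, with $u_i,v_i\in A$, to the word of length $\max(p,q)$ whose $i$-th letter is $(u_i,v_i)$, where $u_i$ is taken to be $\$$ for $i>p$ and $v_i$ is taken to be $\$$ for $i>q$ (so padding is placed on the right). A left-automatic structure for a semigroup $S$ is a pair $(A,L)$ where $A$ is a finite alphabet representing a set of generators for $S$ and $L\subseteq A^+$ is a regular language with $\overline{L}=S$ such that, for each $a\in A\cup\{\varepsilon\}$, the language ${}_aL=\{(u,v): u,v\in L,\ \overline{au}=\overline{v}\}\delta_A$ is regular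 over $A(2,\$)$. A semigroup is left-automatic if it admits a left-automatic structure. *)

(* Defs.v *)
From HB Require Import structures.
From mathcomp Require Import all_boot.
From mathcomp Require Import boolp classical_sets cardinality.

Set Implicit Arguments.
Unset Strict Implicit.
Unset Printing Implicit Defensive.

Local Open Scope classical_set_scope.

(* The free semigroup A^+; a nonempty word is a first letter with a tail. *)
Definition words (A : Type) : Type := (A * seq A)%type.

Definition seq_of_words (A : Type) (u : words A) : seq A := u.1 :: u.2.
Coercion seq_of_words : words >-> seq.

Definition words_mul (A : Type) (u v : words A) : words A :=
  (u.1, u.2 ++ seq_of_words v).

Lemma seq_of_words_mul (A : Type) (u v : words A) :
  seq_of_words (words_mul u v) = seq_of_words u ++ seq_of_words v.
Proof. by []. Qed.

Lemma words_mulA (A : Type) : associative (@words_mul A).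
Proof. by move=> u v w; rewrite /words_mul /= -catA. Qed.

HB.instance Definition _ (A : choiceType) := Choice.on (words A).
HB.instance Definition _ (A : choiceType) :=
  isSemigroup.Build (words A) (@words_mulA A).

Section Presentation.
Variables (A : choiceType) (R : words A -> words A -> Prop).

Inductive pres_cong : words A -> words A -> Prop :=
| pres_rel u v : R u v -> pres_cong u v
| pres_refl u : pres_cong u u
| pres_sym u v : pres_cong u v -> pres_cong v u
| pres_trans u v w : pres_cong u v -> pres_cong v w -> pres_cong u w
| pres_mul u u' v v' : pres_cong u u' -> pres_cong v v' ->
    pres_cong (u * v)%g (u' * v')%g.

Definition pres_congb : rel (words A) := fun u v => `[< pres_cong u v >].

Lemma pres_congb_refl : reflexive pres_congb.
Proof. by move=> u; apply/asboolP; apply: pres_refl. Qed.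

Lemma pres_congb_sym : symmetric pres_congb.
Proof.
by move=> u v; apply/asboolP/asboolP => uv; apply: pres_sym.
Qed.

Lemma pres_congb_trans : transitive pres_congb.
Proof.
move=> v u w /asboolP uv /asboolP vw; apply/asboolP; exact: pres_trans uv vw.
Qed.

Canonical pres_equiv :=
  EquivRel pres_congb pres_congb_refl pres_congb_sym pres_congb_trans.

Definition presented : Type := {eq_quot pres_congb}%qT.

HB.instance Definition _ := Choice.on presented.
HB.instance Definition _ := EqQuotient.on presented.

Definition presented_mul (x y : presented) : presented :=
  (\pi_presented (repr x * repr y)%g)%qT.

Lemma presented_eqP (u v : words A) :
  (\pi_presented u)%qT = (\pi_presented v)%qT <-> pres_cong u v.
Proof.
split=> [/eqquotP /asboolP //|uv]; apply/eqquotP; exact/asboolP.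
Qed.

Lemma presented_mulE (u v : words A) :
  presented_mul (\pi_presented u)%qT (\pi_presented v)%qT
  = (\pi_presented (u * v)%g)%qT.
Proof.
by apply/presented_eqP; apply: pres_mul; apply/presented_eqP; rewrite reprK.
Qed.

Lemma presented_mulA : associative presented_mul.
Proof.
elim/quotW=> u; elim/quotW=> v; elim/quotW=> w.
rewrite (presented_mulE v w) (presented_mulE u v).
by rewrite (presented_mulE u) (presented_mulE _ w) mulgA.
Qed.

HB.instance Definition _ := isSemigroup.Build presented presented_mulA.

End Presentation.

Definition bs_x : bool := false.
Definition bs_y : bool := true.

Definition bs_rel (m n : nat) (u v : words bool) : Prop :=
  u = bs_y :: nseq m bs_x :> seq bool /\
  v = nseq n bs_x ++ [:: bs_y] :> seq bool.

Definition baumslag_solitar (m n : nat) : semigroupType :=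
  presented (bs_rel m n).

Section Generation.
Variable S : semigroupType.

Definition mul_closed (M : set S) : Prop :=
  forall x y, M x -> M y -> M (x * y)%g.

Definition generates (X : set S) : Prop := smallest mul_closed X = setT.

Definition finitely_generated : Prop :=
  exists2 X : set S, finite_set X & generates X.

End Generation.

Record dfa (A : Type) := Dfa {
  dfa_state : finType;
  dfa_init : dfa_state;
  dfa_final : pred dfa_state;
  dfa_step : dfa_state -> A -> dfa_state
}.

Definition dfa_accept (A : Type) (M : dfa A) (w : seq A) : bool :=
  dfa_final (foldl (@dfa_step A M) (dfa_init M) w).

Definition regular (A : finType) (L : set (seq A)) : Prop :=
  exists M : dfa A, L = [set w | dfa_accept M w].

(* The alphabet A(2,$), with None in the role of the padding symbol $. *)
Definition pad_letter (A : finType) : finType :=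
  {p : option A * option A | p != (None, None)}.

(* No letter is dropped by [insub]: see [val_conv]. *)
Definition conv (A : finType) (u v : words A) : seq (pad_letter A) :=
  pmap insub
    (mkseq (fun i => (onth u i, onth v i)) (maxn (size u) (size v))).

Lemma val_conv (A : finType) (u v : words A) :
  map val (conv u v) =
  mkseq (fun i => (onth u i, onth v i)) (maxn (size u) (size v)).
Proof.
rewrite /conv pmap_filter; last by move=> p /=; case: insubP.
apply/all_filterP/allP => p /mapP[i]; rewrite mem_iota add0n /= => i_lt ->.
case: insubP => //= /negPn /eqP[ui vi].
have onthN (s : seq A) : onth s i = None -> size s <= i.
  by elim: s i {i_lt ui vi} => [|a s IHs] [|i] //= /IHs.
move: i_lt; rewrite ltnNge geq_max.
by rewrite (onthN (seq_of_words u) ui) (onthN (seq_of_words v) vi).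
Qed.

Section LeftAutomatic.
Variables (S : semigroupType) (A : finType) (phi : A -> S).

Definition eval (w : words A) : S :=
  foldl (fun s a => s * phi a)%g (phi w.1) w.2.

Lemma eval_mul (u v : words A) : eval (u * v)%g = (eval u * eval v)%g.
Proof.
rewrite /eval foldl_cat /=; elim/last_ind: v.2 => [|s a IHs] //=.
by rewrite -!cats1 !foldl_cat /= IHs mulgA.
Qed.

(* The word au, for a in A or a empty (None). *)
Definition opt_cons (a : option A) (u : words A) : words A :=
  if a is Some b then (b, seq_of_words u) else u.

Definition left_mul_language (L : set (words A)) (a : option A) :
    set (seq (pad_letter A)) :=
  [set c | exists u v, [/\ L u, L v, eval (opt_cons a u) = eval v
                         & c = conv u v]].

Definition left_automatic_structure (L : set (words A)) : Prop :=
  [/\ generates (range phi),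
      regular [set seq_of_words w | w in L],
      eval @` L = setT
    & forall a : option A, regular (left_mul_language L a)].

End LeftAutomatic.

Definition left_automatic (S : semigroupType) : Prop :=
  exists (A : finType) (phi : A -> S) (L : set (words A)),
    left_automatic_structure phi L.

(* Main.v *)
Require Import Defs.
From mathcomp Require Import all_boot.
From mathcomp Require Import zify.
From mathcomp Require Import boolp classical_sets cardinality.

(** Orient the relation as [x^n y -> y x^m].  Every
    element has a unique normal form [x^d1 y ... x^dr y x^e] with all digits
    [di < n]; reading one more letter [x] on the right increments [e], reading
    [y] appends the digit [e %% n] and leaves the carry [m * (e %/ n)].  Since
    [m < n], carries cannot accumulate: after factors of bounded size, each
    containing a [y], the carry is bounded ([act_expo_deg]).  The digits
    already produced never change again, so prefixes
    of two words for the same element agree digit by digit, and the semigroup is left cancellative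
    ([nf_cancel]).  Hence, if [p s = q t] where [p] and [q] have bounded
    carries and almost equally many letters [y], then [p = g D] and [q = g D']
    with [D] and [D'] short ([close_common_multiple]).

    It remains to choose for a finitely generated subsemigroup [T] a language
    of representatives whose prefixes of length [i] all have about the same
    number of letters [y].  As [x^(n^d) g = g x^(m^d)] for [g] with [d]
    letters [y] ([nf_move]), powers of [x] in [T] can be pushed to the right,
    and an element of [T] is a product of factors from a finite subset of [T],
    each containing a [y], followed by a bounded power of [x] and by a power
    of a fixed [x^k] in [T] ([syllables]).  Consecutive factors are grouped
    greedily into blocks so that the first [i] blocks have between [N * i] and
    [N * i + N - 1] letters [y] ([grouping]).  The letters of the automatic
    structure are the tagged short words that spell elements of [T], and its language
    consists of the sequences of such blocks, at most one remainder, and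
    copies of [x^k].

    If [w u = v] for two words [u], [v] of this language and a short word [w],
    then the prefixes of [w u] and [v] remain close throughout
    ([fellow_traveller]), also inside the final powers of [x], which have
    bounded difference.  By cancellation only finitely many relations
    [p s = q t] between the possible continuations [s], [t] arise, and a
    Myhill-Nerode argument for pairs of words read in parallel
    ([regular_synchronous]) makes the multiplier languages regular. *)

Set Implicit Arguments.
Unset Strict Implicit.
Unset Printing Implicit Defensive.

Local Open Scope classical_set_scope.

Local Notation x := bs_x.
Local Notation y := bs_y.

(** * Normal forms in the Baumslag-Solitar semigroup *)

(** The number of letters [y], an invariant of the defining relation. *)
Definition deg (w : seq bool) : nat := count id w.

Lemma deg_cat u v : deg (u ++ v) = deg u + deg v.
Proof. exact: count_cat. Qed.

Lemma deg_nseq k : deg (nseq k x) = 0.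
Proof. by rewrite /deg count_nseq. Qed.

Lemma deg_size w : deg w <= size w.
Proof. exact: count_size. Qed.

Lemma deg0P w : deg w = 0 -> w = nseq (size w) x.
Proof.
by elim: w => [|[] w IHw] //=; rewrite /deg /= add0n => /IHw <-.
Qed.

Lemma cat_nseq_cat a b w : nseq a x ++ (nseq b x ++ w) = nseq (a + b) x ++ w.
Proof. by rewrite catA -nseqD. Qed.

Section NormalForm.

Variables (m n : nat).
Hypothesis (lt_mn : m < n).

(** The pair [(ds, e)] stands for the normal form with digits [ds] before the
    letters [y] and final exponent [e]. *)
Definition conf : Type := (seq nat * nat)%type.

Definition bs_step (c : conf) (b : bool) : conf :=
  if b then (rcons c.1 (c.2 %% n), m * (c.2 %/ n)) else (c.1, c.2.+1).

Definition act (c : conf) (w : seq bool) : conf := foldl bs_step c w.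

Definition nf (w : seq bool) : conf := act ([::], 0) w.

Definition digits_word (ds : seq nat) : seq bool :=
  flatten [seq nseq d x ++ [:: y] | d <- ds].

Definition conf_word (c : conf) : seq bool :=
  digits_word c.1 ++ nseq c.2 x.

Lemma act_cat c u v : act c (u ++ v) = act (act c u) v.
Proof. exact: foldl_cat. Qed.

Lemma nf_cat u v : nf (u ++ v) = act (nf u) v.
Proof. exact: act_cat. Qed.

Lemma act_nseq ds e k : act (ds, e) (nseq k x) = (ds, e + k).
Proof. by elim: k e => [|k IHk] e /=; rewrite ?addn0 // IHk addSnnS. Qed.

Lemma act_digits ds0 ds e w :
  act (ds0 ++ ds, e) w = (ds0 ++ (act (ds, e) w).1, (act (ds, e) w).2).
Proof. by elim: w ds e => [|[] w IHw] ds e //=; rewrite ?rcons_cat IHw. Qed.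

Lemma size_act c w : size (act c w).1 = size c.1 + deg w.
Proof.
elim: w c => [|[] w IHw] c /=; rewrite ?addn0 // IHw //= size_rcons /deg /=.
by rewrite addnA addn1.
Qed.

Lemma act_ltn c w :
  all (fun d => d < n) c.1 -> all (fun d => d < n) (act c w).1.
Proof.
elim: w c => [|[] w IHw] c //= c_lt; apply: IHw => //=.
by rewrite all_rcons c_lt ltn_mod (leq_trans _ lt_mn).
Qed.

Lemma digits_word_rcons ds d :
  digits_word (rcons ds d) = digits_word ds ++ nseq d x ++ [:: y].
Proof. by rewrite /digits_word map_rcons -cats1 flatten_cat /= cats0. Qed.

Lemma size_digits_word ds :
  all (fun d => d < n) ds -> size (digits_word ds) <= n * size ds.
Proof.
elim: ds => [|d ds IHds] //= /andP[d_lt /IHds le_ds].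
by rewrite /digits_word /= !size_cat size_nseq /= mulnS addn1 leq_add.
Qed.

(** Congruence on possibly empty words: the presented semigroup with an
    identity adjoined, where concatenation needs no side conditions. *)
Definition scong (u v : seq bool) : Prop :=
  u = v \/ exists u' v' : words bool,
    [/\ u = u', v = v' & pres_cong (bs_rel m n) u' v'].

Lemma scong_trans u v w : scong u v -> scong v w -> scong u w.
Proof.
case=> [-> //|[u1 [v1 [-> -> uv]]]] [<-|[v2 [w2 [vE -> vw]]]].
  by right; exists u1, v1.
right; exists u1, w2; split=> //; apply: pres_trans uv _.
by case: v1 v2 vE vw => [a s] [b t] [-> ->].
Qed.

Lemma scong_sym u v : scong u v -> scong v u.
Proof.
case=> [->|[u1 [v1 [-> -> uv]]]]; first by left.
by right; exists v1, u1; split=> //; apply: pres_sym.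
Qed.

Lemma scong_catl u v w : scong u v -> scong (w ++ u) (w ++ v).
Proof.
case=> [->|[u1 [v1 [-> -> uv]]]]; first by left.
case: w => [|a w]; first by right; exists u1, v1.
right; exists (words_mul (a, w) u1), (words_mul (a, w) v1); split=> //.
by apply: pres_mul => //; apply: pres_refl.
Qed.

Lemma scong_catr u v w : scong u v -> scong (u ++ w) (v ++ w).
Proof.
case=> [->|[u1 [v1 [-> -> uv]]]]; first by left.
case: w => [|a w]; first by rewrite !cats0; right; exists u1, v1.
right; exists (words_mul u1 (a, w)), (words_mul v1 (a, w)); split=> //.
by apply: pres_mul => //; apply: pres_refl.
Qed.

Lemma scong_rel : scong (nseq n x ++ [:: y]) (y :: nseq m x).
Proof.
right; exists (x, nseq n.-1 x ++ [:: y]), (y, nseq m x).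
have xn : nseq n x ++ [:: y] = x :: nseq n.-1 x ++ [:: y] by case: (n) lt_mn.
by split=> //; apply: pres_sym; apply: pres_rel; split.
Qed.

(** Iterating the defining relation: [y] turns each block of [n] letters [x]
    on its left into [m] letters [x] on its right. *)
Lemma scong_move q : scong (nseq (n * q) x ++ [:: y]) (y :: nseq (m * q) x).
Proof.
elim: q => [|q IHq]; first by left; rewrite !muln0.
rewrite !mulnS nseqD -catA; apply: scong_trans (scong_catl _ IHq) _.
rewrite -cat1s catA nseqD -cat_cons.
exact/scong_catr/scong_rel.
Qed.

Lemma scong_conf_word w : scong w (conf_word (nf w)).
Proof.
elim/last_ind: w => [|w b IHw]; first by left.
rewrite -cats1; apply: scong_trans (scong_catr _ IHw) _.
rewrite nf_cat; case: (nf w) => ds e; case: b => /=.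
  rewrite /conf_word /= digits_word_rcons -!catA; apply: scong_catl.
  rewrite {1}(divn_eq e n) addnC mulnC nseqD -catA; apply: scong_catl.
  exact: scong_move.
by left; rewrite /conf_word /= -catA -[[:: false]]/(nseq 1 x) -nseqD addn1.
Qed.

Lemma pres_cong_act (u v : words bool) c :
  pres_cong (bs_rel m n) u v -> act c u = act c v.
Proof.
have n_gt0 : 0 < n by apply: leq_trans lt_mn.
move=> uv; elim: uv c => {u v} [u v [-> ->]|u|u v _ IH|u v w _ IH1 _ IH2|
    u u' v v' _ IHu _ IHv] [ds e].
- rewrite act_cat act_nseq /= act_nseq /= modnDr; congr pair.
  by rewrite divnDr ?dvdnn // divnn n_gt0 mulnDr muln1.
- by [].
- by rewrite IH.
- by rewrite IH1.
- by rewrite !seq_of_words_mul !act_cat IHu IHv.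
Qed.

(** Soundness and completeness of the normal form: [nf] is computed by a right
    action compatible with the defining relation, and every word is congruent
    to the word of its normal form. *)
Lemma scong_nf u v : scong u v <-> nf u = nf v.
Proof.
split=> [[-> //|[u1 [v1 [-> -> uv]]]]|uv]; first exact: pres_cong_act.
apply: scong_trans (scong_conf_word u) _; rewrite uv.
exact/scong_sym/scong_conf_word.
Qed.

Lemma nf_pres (u v : words bool) : pres_cong (bs_rel m n) u v <-> nf u = nf v.
Proof.
split=> [|/scong_nf]; first exact: pres_cong_act.
case: u v => [a u] [b v] [[-> ->]|]; first exact: pres_refl.
by case=> -[a' u'] [[b' v'] [[-> ->] [-> ->]]].
Qed.

Lemma nf_catl u v w : nf u = nf v -> nf (w ++ u) = nf (w ++ v).
Proof. by move=> /scong_nf uv; apply/scong_nf/scong_catl. Qed.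

Lemma nf_catr u v w : nf u = nf v -> nf (u ++ w) = nf (v ++ w).
Proof. by rewrite !nf_cat => ->. Qed.

Lemma nf_conf_word w : nf (conf_word (nf w)) = nf w.
Proof. by apply/esym/scong_nf/scong_conf_word. Qed.

Lemma nf_ltn w : all (fun d => d < n) (nf w).1.
Proof. exact: act_ltn. Qed.

Lemma size_nf w : size (nf w).1 = deg w.
Proof. by rewrite size_act. Qed.

Lemma nf_act u v c : nf u = nf v -> act c u = act c v.
Proof.
move=> /scong_nf[-> //|[u1 [v1 [-> -> uv]]]]; exact: pres_cong_act.
Qed.

(** A carry [c] entering a normal form from the left can be recovered digit
    by digit, because digits are smaller than [n]. *)
Lemma act_conf_word_inj c ds ds' e e' :
    all (fun d => d < n) ds -> all (fun d => d < n) ds' ->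
    act ([::], c) (conf_word (ds, e)) = act ([::], c) (conf_word (ds', e')) ->
  (ds, e) = (ds', e').
Proof.
have actE d f fs k : act ([::], f) (conf_word (d :: fs, k)) =
   ((f + d) %% n :: (act ([::], m * ((f + d) %/ n)) (conf_word (fs, k))).1,
    (act ([::], m * ((f + d) %/ n)) (conf_word (fs, k))).2).
  rewrite /conf_word /digits_word /= -!catA act_cat act_nseq /=.
  by rewrite -[[:: _]]/([:: (f + d) %% n] ++ [::]) act_digits.
elim: ds ds' c => [|d ds IHds] [|d' ds'] c.
- by rewrite /conf_word /= !act_nseq => _ _ [/addnI->].
- by rewrite actE /conf_word /= act_nseq.
- by rewrite actE /conf_word /= act_nseq.
move=> /= /andP[d_lt ds_lt] /andP[d'_lt ds'_lt].
rewrite !actE => -[/eqP + eq1 eq2].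
rewrite eqn_modDl !modn_small // => /eqP dd'; subst d'.
have /IHds : act ([::], m * ((c + d) %/ n)) (conf_word (ds, e)) =
     act ([::], m * ((c + d) %/ n)) (conf_word (ds', e')).
  exact: injective_projections.
by move=> /(_ ds_lt ds'_lt)[-> ->].
Qed.

(** Left cancellation.  Digits produced by [g] are final, so [g] influences
    what follows only through its carry, which [act_conf_word_inj] removes. *)
Lemma nf_cancel g s t : nf (g ++ s) = nf (g ++ t) -> nf s = nf t.
Proof.
rewrite !nf_cat; case: (nf g) => ds e.
rewrite -[ds]cats0 !act_digits => -[/eqP + eq2].
rewrite eqseq_cat // eqxx /= => /eqP eq1.
have : act ([::], e) s = act ([::], e) t.
  exact: injective_projections.
rewrite -(nf_act _ (nf_conf_word s)) -(nf_act _ (nf_conf_word t)).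
have := nf_ltn s; have := nf_ltn t; case: (nf s) (nf t) => [ds1 e1] [ds2 e2].
by move=> lt2 lt1; apply: act_conf_word_inj.
Qed.

(** Each of the [deg g] letters [y] in [g] replaces a factor [n] of the
    exponent by a factor [m]; the letters [x] of [g] commute with it. *)
Lemma nf_move g q :
  nf (nseq (n ^ deg g * q) x ++ g) = nf (g ++ nseq (m ^ deg g * q) x).
Proof.
elim: g q => [|[] g IHg] q /=.
- by rewrite !expn0 cats0.
- rewrite /deg /= -/(deg g) !expnS -!mulnA -cat1s catA.
  have /scong_nf/(@nf_catr _ _ g) -> := scong_move (n ^ deg g * q).
  rewrite mulnCA -[true :: g ++ _]cat1s -[y :: nseq _ _]cat1s -!catA.
  by apply: nf_catl; rewrite IHg [in RHS]mulnCA.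
- rewrite /deg /= add0n -/(deg g).
  have -> w k : nseq k x ++ x :: w = [:: x] ++ (nseq k x ++ w).
    by elim: k => [|k IHk] //=; rewrite IHk.
  by rewrite -[false :: g ++ _]cat1s; apply: nf_catl.
Qed.

Lemma act_expo w c : (act c w).2 <= c.2 + size w.
Proof.
elim: w c => [|[] w IHw] c /=; rewrite ?addn0 //; apply: leq_trans (IHw _) _ => /=.
  have := leq_divM c.2 n; nia.
by rewrite addSnnS.
Qed.

(** The carry stays bounded: a word of size at most [K] adds at most [K] to
    the exponent, but a letter [y] scales it by a factor at most [m / n]. *)
Lemma act_expo_deg w c K :
  0 < deg w -> size w <= K -> c.2 <= K * n -> (act c w).2 <= K * n.
Proof.
rewrite -has_count => /hasP[b w_b]; case: b w_b => // /splitPr[w1 w2].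
rewrite size_cat act_cat /=.
have := act_expo w1 c; case: (act c w1) => ds e /= e_le _ w_le c_le.
apply: leq_trans (act_expo _ _) _ => /=.
have := leq_divM e n; have := ltn_ceil e (leq_ltn_trans (leq0n m) lt_mn).
move: (e %/ n) => q; nia.
Qed.

End NormalForm.

(** * Prefixes of equal elements stay close *)

Section FellowTraveller.

Variables (m n : nat).
Hypothesis (lt_mn : m < n).

Local Notation nf := (nf m n).

(** Bounded word difference, expressed by a common left factor [g] for want of
    inverses. *)
Definition close C (p q : seq bool) : Prop := exists g D D',
  [/\ size D <= C, size D' <= C, nf p = nf (g ++ D) & nf q = nf (g ++ D')].

Lemma close_sym C p q : close C p q -> close C q p.
Proof. by case=> g [D [D' [? ? ? ?]]]; exists g, D', D. Qed.

Lemma close_leq C C' p q : C <= C' -> close C p q -> close C' p q.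
Proof.
move=> leC [g [D [D' [leD leD' pE qE]]]]; exists g, D, D'.
by split=> //; [apply: leq_trans leD leC|apply: leq_trans leD' leC].
Qed.

Lemma close_cat C k p q s t :
  close C p q -> size s <= k -> size t <= k -> close (C + k) (p ++ s) (q ++ t).
Proof.
case=> g [D [D' [leD leD' pE qE]]] les let_.
exists g, (D ++ s), (D' ++ t); rewrite !size_cat !leq_add // !catA.
by split=> //; apply: nf_catr.
Qed.

(** By left cancellation, close words are interchangeable with a pair of
    short ones, of which there are finitely many. *)
Lemma close_residual C p q : close C p q ->
  exists D D', [/\ size D <= C, size D' <= C &
    forall s t, nf (p ++ s) = nf (q ++ t) <-> nf (D ++ s) = nf (D' ++ t)].
Proof.
case=> g [D [D' [leD leD' pE qE]]]; exists D, D'; split=> // s t.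
rewrite (nf_catr s pE) (nf_catr t qE) -!catA.
by split=> [|st]; [apply: nf_cancel | apply: nf_catl].
Qed.

(** Digits once written are final, so a common right multiple forces the
    digits of the word with fewer letters [y] to be a prefix [g] of the digits
    of the other.  What remains after [g] is at most [d] further digits, each
    below [n], and the two carries. *)
Lemma close_common_multiple C d p q s t :
    (nf p).2 <= C -> (nf q).2 <= C -> deg p <= deg q + d -> deg q <= deg p + d ->
    nf (p ++ s) = nf (q ++ t) ->
  close (C + n * d) p q.
Proof.
wlog le_pq : p q s t / deg p <= deg q => [hwlog|].
  case: (leqP (deg p) (deg q)) => [/hwlog|/ltnW/hwlog]; first exact.
  by move=> H ? ? ? ? /esym /H H'; apply/close_sym/H'.
move=> ple qle _ leq_pq; rewrite !nf_cat.
have := nf_conf_word lt_mn p; have := nf_conf_word lt_mn q.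
have := nf_ltn lt_mn q; have := size_nf m n p; have := size_nf m n q.
move: ple qle; case Ep: (nf p) => [ds e]; case Eq: (nf q) => [fs f] /= ple qle.
move=> sz_f sz_d f_lt qE pE.
rewrite -[ds]cats0 -[fs]cats0 !act_digits => -[dsfs _].
have szdf : size ds <= size fs by rewrite sz_f sz_d.
have dsE : ds = take (size ds) fs.
  move/(congr1 (take (size ds))): dsfs.
  by rewrite take_size_cat // takel_cat.
move: dsE; set i := size ds => dsE.
exists (digits_word (take i fs)), (nseq e x), (digits_word (drop i fs) ++ nseq f x).
split.
- by rewrite size_nseq; lia.
- rewrite size_cat size_nseq.
  have : all (fun d => d < n) (drop i fs).
    by move: f_lt; rewrite -{1}(cat_take_drop i fs) all_cat => /andP[].
  move=> /size_digits_word; rewrite size_drop /i sz_f sz_d.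
  have : n * (deg q - deg p) <= n * d by rewrite leq_mul2l; apply/orP; right; lia.
  lia.
- by rewrite Ep -dsE pE.
- by rewrite Eq catA -flatten_cat -map_cat cat_take_drop qE.
Qed.

(** Each block completes exactly one more multiple of [N] letters [y]; [off] is the excess
    left by the blocks already read. *)
Fixpoint paced N off (ls : seq (seq bool)) : bool :=
  if ls is l :: ls' then
    (N <= off + deg l < 2 * N) && paced N (off + deg l - N) ls'
  else true.

Lemma deg_paced N off ls i : off < N -> paced N off ls -> i <= size ls ->
  N * i <= off + deg (flatten (take i ls)) < N * i.+1.
Proof.
elim: ls off i => [|l ls IHls] off [|i] //= off_lt.
- by rewrite muln0 muln1 addn0 off_lt.
- by rewrite muln0 muln1 addn0 off_lt.
move=> /andP[l_deg ls_ok]; rewrite ltnS => i_le.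
have := IHls _ i _ ls_ok i_le; rewrite deg_cat !mulnS; lia.
Qed.

Lemma expo_paced N off K ls p i :
    off < N -> paced N off ls -> all (fun l => size l <= K) ls ->
    (nf p).2 <= K * n -> 
  (nf (p ++ flatten (take i ls))).2 <= K * n.
Proof.
elim: ls off i p => [|l ls IHls] off [|i] p off_lt /=; rewrite ?cats0 //.
move=> /andP[l_deg ls_ok] /andP[l_le ls_le] p_le.
rewrite catA; apply: (IHls _ _ _ _ ls_ok) => //; first lia.
rewrite nf_cat; apply: act_expo_deg => //; lia.
Qed.

Lemma size_flatten_leq K (ls : seq (seq bool)) :
  all (fun l => size l <= K) ls -> size (flatten ls) <= size ls * K.
Proof.
by elim: ls => [|l ls IHls] //= /andP[l_le /IHls le]; rewrite size_cat mulSn leq_add.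
Qed.

Definition tail k t : seq (seq bool) := nseq t (nseq k x).

Lemma flatten_tail k t : flatten (tail k t) = nseq (k * t) x.
Proof. by elim: t => [|t IHt] /=; rewrite ?muln0 // IHt mulnS nseqD. Qed.

(** Behind the last [y] both words are read at the same speed, one [x^k] per
    letter, until one of them ends.  Their exponents differ by a bounded amount
    at the start and agree at the end, so they never drift apart. *)
Lemma close_tails C k i1 i2 t1 t2 d p q :
    (nf p).2 <= C -> (nf q).2 <= C ->
    i1 <= i2 + d -> i2 <= i1 + d ->
    nf (p ++ nseq (k * t1) x) = nf (q ++ nseq (k * t2) x) ->
  close (C + k * d) (p ++ nseq (k * minn i1 t1) x)
                    (q ++ nseq (k * minn i2 t2) x).
Proof.
have := nf_conf_word lt_mn p; have := nf_conf_word lt_mn q.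
rewrite !nf_cat; case Ep: (nf p) => [ds e]; case Eq: (nf q) => [fs f] /=.
move=> /esym/(etrans Eq) qE /esym/(etrans Ep) pE p_le q_le.
move=> le1 le2; rewrite !act_nseq => -[dsfs ef]; rewrite -{}dsfs {fs} in Eq qE.
have {}le1 : k * i1 <= k * i2 + k * d by rewrite -mulnDr leq_mul2l le1 orbT.
have {}le2 : k * i2 <= k * i1 + k * d by rewrite -mulnDr leq_mul2l le2 orbT.
rewrite !minnMr; set s1 := minn _ _; set s2 := minn (k * i2) _.
set b := minn (e + s1) (f + s2).
exists (digits_word ds ++ nseq b x), (nseq (e + s1 - b) x), (nseq (f + s2 - b) x).
rewrite !size_nseq; split; [by lia|by lia|..].
  rewrite -catA -nseqD -[b + _]maxnE (maxn_idPr _) ?geq_minl // nseqD catA.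
  by rewrite !nf_cat pE.
rewrite -catA -nseqD -[b + _]maxnE (maxn_idPr _) ?geq_minr // nseqD catA.
by rewrite !nf_cat qE.
Qed.

(** The carries contribute [K * n] and the difference in degree [n * (N + K)];
    the last two summands pay for the at most [2 * K + 2] letters that one
    word may be ahead of the other, and for the remainders. *)
Definition fellow_bound N K : nat := K * n + n * (N + K) + (2 * K + 2) * K + K.

Lemma take_cat3 (T : Type) (a b c : seq T) i : size a + size b <= i ->
  take i (a ++ b ++ c) = a ++ b ++ take (i - (size a + size b)) c.
Proof.
by move=> le_i; rewrite catA take_cat size_cat ltnNge le_i /= catA.
Qed.

(** Both words have [y]-degree about [N * i] after [i] blocks, so their numbers
    of blocks differ by at most [2 * K + 1].  As long as one of them is still
    reading blocks, cut both at the last length [j] where both read blocks and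
    apply [close_common_multiple]; fewer than [2 * K + 3] letters follow.  Once
    both have passed their remainder, only powers of [x] are left and
    [close_tails] applies. *)
Lemma fellow_traveller N K k w u v ls ls' rs rs' t t' i :
    0 < N -> k <= K -> size w <= K ->
    all (fun l => size l <= K) u -> all (fun l => size l <= K) v ->
    u = ls ++ rs ++ tail k t -> v = ls' ++ rs' ++ tail k t' ->
    paced N 0 ls -> paced N 0 ls' -> size rs <= 1 -> size rs' <= 1 ->
    nf (w ++ flatten u) = nf (flatten v) ->
  close (fellow_bound N K) (w ++ flatten (take i u)) (flatten (take i v)).
Proof.
move=> N_gt0 k_le w_le u_le v_le uE vE ls_ok ls'_ok rs_le rs'_le uv.
have w_exp : (nf w).2 <= K * n.
  by apply: leq_trans (act_expo lt_mn _ _) _ => /=; nia.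
have [ls_le1 rs_le1] :
    all (fun l => size l <= K) ls /\ all (fun l => size l <= K) rs.
  by move: u_le; rewrite uE !all_cat => /and3P[].
have [ls'_le1 rs'_le1] :
    all (fun l => size l <= K) ls' /\ all (fun l => size l <= K) rs'.
  by move: v_le; rewrite vE !all_cat => /and3P[].
have fl_rs : size (flatten rs) <= K.
  by apply: leq_trans (size_flatten_leq rs_le1) _; nia.
have fl_rs' : size (flatten rs') <= K.
  by apply: leq_trans (size_flatten_leq rs'_le1) _; nia.
have deg_rs := leq_trans (deg_size (flatten rs)) fl_rs.
have deg_rs' := leq_trans (deg_size (flatten rs')) fl_rs'.
have deg_w := leq_trans (deg_size w) w_le.
have deg_eq : deg w + deg (flatten ls) + deg (flatten rs) =
    deg (flatten ls') + deg (flatten rs').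
  have := congr1 (fun c : conf => size c.1) uv.
  rewrite uE vE !size_nf !flatten_cat !deg_cat !flatten_tail !deg_nseq; lia.
have dls j : j <= size ls -> _ := fun le => deg_paced N_gt0 ls_ok le.
have dls' j : j <= size ls' -> _ := fun le => deg_paced N_gt0 ls'_ok le.
have h_le : size ls <= size ls' + (2 * K + 1).
  have := dls _ (leqnn _); have := dls' _ (leqnn _).
  rewrite !take_size; nia.
have h'_le : size ls' <= size ls + (2 * K + 1).
  have := dls _ (leqnn _); have := dls' _ (leqnn _).
  rewrite !take_size; nia.
(* [.+1] leaves room for the remainder letter behind the blocks. *)
case: (leqP i (maxn (size ls) (size ls')).+1) => [i_le|i_gt].
  pose j := minn i (minn (size ls) (size ls')).
  have jls : j <= size ls by lia.
  have jls' : j <= size ls' by lia.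
  have prefixE (s0 r z : seq (seq bool)) : j <= size s0 -> z = s0 ++ r ->
      take i z = take j s0 ++ drop j (take i z).
    move=> js ->; rewrite -{1}(cat_take_drop j (take i (s0 ++ r))).
    rewrite take_takel ?geq_minl //.
    by rewrite takel_cat.
  have size_ext z : all (fun l : seq bool => size l <= K) z ->
     size (flatten (drop j (take i z))) <= (2 * K + 2) * K.
    move=> le; apply: leq_trans (size_flatten_leq (K := K) _) _.
      move: le; rewrite -{1}(cat_take_drop i z) all_cat => /andP[+ _].
      by rewrite -{1}(cat_take_drop j (take i _)) all_cat => /andP[].
    rewrite leq_mul2r size_drop size_take_min; apply/orP; right; lia.
  rewrite (prefixE ls _ u jls uE) (prefixE ls' _ v jls' vE) !flatten_cat catA.
  apply: (@close_leq (K * n + n * (N + K) + (2 * K + 2) * K)).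
    by rewrite /fellow_bound leq_addr.
  apply: close_cat; try exact: size_ext.
  have dp : deg (w ++ flatten (take j ls)) = deg w + deg (flatten (take j ls)).
    exact: deg_cat.
  have := dls _ jls; have := dls' _ jls'; rewrite !mulnS !add0n => d1 d2.
  apply: (@close_common_multiple _ _ _ _
    (flatten (drop j u)) (flatten (drop j v))); rewrite ?dp; try lia.
  - exact: expo_paced N_gt0 ls_ok _ _.
  - by rewrite -[flatten _]cat0s; apply: (expo_paced j N_gt0 ls'_ok _ _).
  - have uj : take j ls = take j u by rewrite uE takel_cat.
    have vj : take j ls' = take j v by rewrite vE takel_cat.
    by rewrite uj vj -catA -!flatten_cat !cat_take_drop.
rewrite uE vE !take_cat3; try by lia.
have take_tail j t0 : take j (tail k t0) = tail k (minn j t0).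
  elim: j t0 => [|j IHj] [|t0] /=; rewrite ?minn0 ?min0n //.
  by rewrite minnSS /= -/(tail k t0) IHj.
rewrite !take_tail !flatten_cat !flatten_tail !catA.
apply: (@close_leq (K * n + K + k * (2 * K + 2))).
  rewrite /fellow_bound.
  have : k * (2 * K + 2) <= (2 * K + 2) * K by nia.
  lia.
apply: close_tails; rewrite ?nf_cat; try by lia.
- apply: leq_trans (act_expo lt_mn _ _) _; rewrite leq_add // -nf_cat.
  by rewrite -[ls]take_size; apply: (expo_paced _ N_gt0 ls_ok _ _).
- apply: leq_trans (act_expo lt_mn _ _) _; rewrite leq_add //.
  rewrite -[ls']take_size -[flatten _]cat0s.
  by apply: (expo_paced _ N_gt0 ls'_ok _ _).
- by move: uv; rewrite uE vE !flatten_cat !flatten_tail !catA !nf_cat.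
Qed.

End FellowTraveller.

(** * Regular languages from finitely many residuals *)

Section Residuals.

Variables (A : finType) (L : set (seq A)).
Variables (Q : finType) (dec : Q -> set (seq A)).

Definition residual (p : seq A) : set (seq A) := [set t | L (p ++ t)].

Definition state_of (D : set (seq A)) : option Q := [pick q | `[< dec q = D >]].

Definition residual_dfa : dfa A :=
  @Dfa A (option Q) (state_of L)
    (fun o => if o is Some q then `[< dec q [::] >] else false)
    (fun o a => if o is Some q then state_of [set t | dec q (a :: t)] else None).

(** Only prefixes of words of [L] must have a residual in the finite family
    [dec]; a prefix whose residual is not in it goes to the sink state [None]. *)
Lemma regular_residuals :
  (forall p s, L (p ++ s) -> exists q, residual p = dec q) -> regular L.
Proof.
move=> live; exists residual_dfa.
have dfaP p : let o := foldl (@dfa_step A residual_dfa) (dfa_init residual_dfa) p in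
    (exists2 q, o = Some q & dec q = residual p) \/
    (o = None /\ forall s, ~ L (p ++ s)).
  elim/last_ind: p => [|p a IHp] /=.
    rewrite /state_of; case: pickP => [q /asboolP qL|no_q].
      by left; exists q.
    right; split=> // s /(live [::])[q qL].
    by have /asboolP := no_q q; rewrite -qL.
  rewrite -cats1 foldl_cat /=; case: IHp => [[q -> qE]|[-> no_s]]; last first.
    by right; split=> // s; rewrite -catA; apply: no_s.
  have -> : [set t | dec q (a :: t)] = residual (p ++ [:: a]).
    by apply/funext => t; rewrite qE /residual /= -catA.
  rewrite /state_of; case: pickP => [q' /asboolP q'E|no_q].
    by left; exists q'.
  right; split=> // s /live[q' q'E].
  by have /asboolP := no_q q'; rewrite q'E.
apply/seteqP; split=> w; rewrite /= /dfa_accept.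
  case: (dfaP w) => [[q -> qE]|[_ no_s]] Lw.
    by apply/asboolP; rewrite qE /residual /= cats0.
  by have := no_s [::]; rewrite cats0.
case: (dfaP w) => [[q -> qE]|[-> _]] //= /asboolP.
by rewrite qE /residual /= cats0.
Qed.

End Residuals.

Section Synchronous.

Variable A : finType.

Local Notation padded := (seq (option A * option A)).

(** A recursive form of the convolution, better suited to induction than its
    definition by indices. *)
Fixpoint zip_pad (u v : seq A) : padded :=
  match u, v with
  | [::], _ => [seq (None, Some b) | b <- v]
  | _, [::] => [seq (Some a, None) | a <- u]
  | a :: u', b :: v' => (Some a, Some b) :: zip_pad u' v'
  end.

Lemma zip_pad0 u : zip_pad u [::] = [seq (Some a, None) | a <- u].
Proof. by case: u. Qed.

Lemma zip_padE u v : zip_pad u v =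
  mkseq (fun i => (onth u i, onth v i)) (maxn (size u) (size v)).
Proof.
have shift f k : mkseq f k.+1 = f 0 :: mkseq (fun i => f i.+1) k :> padded.
  by rewrite /mkseq /= -add1n iotaDl -map_comp.
elim: u v => [|a u IHu] v.
  rewrite max0n; elim: v => [|b v IHv] //=; rewrite shift /=; congr cons.
  by move: IHv => /= ->; apply: eq_mkseq => -[].
case: v => [|b v]; last by rewrite /= maxnSS shift /= IHu.
rewrite maxn0 shift /= -zip_pad0 IHu maxn0; congr cons.
by apply: eq_mkseq => -[].
Qed.

(** The flags record whether each track is still unpadded, since a track may
    not resume after a padding symbol. *)
Fixpoint well_padded (b1 b2 : bool) (c : padded) : bool :=
  if c is l :: c' then
    [&& isSome l.1 ==> b1, isSome l.2 ==> b2 &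
      well_padded (b1 && isSome l.1) (b2 && isSome l.2) c']
  else true.

Definition still1 (c : padded) : bool := all (fun l => isSome l.1) c.
Definition still2 (c : padded) : bool := all (fun l => isSome l.2) c.

Lemma well_padded_cat b1 b2 c d : well_padded b1 b2 (c ++ d) =
  well_padded b1 b2 c && well_padded (b1 && still1 c) (b2 && still2 c) d.
Proof.
elim: c b1 b2 => [|l c IHc] b1 b2 /=; rewrite ?andbT // IHc.
by rewrite !andbA.
Qed.

Definition proj1 (c : padded) : seq A := pmap (fun l => l.1) c.
Definition proj2 (c : padded) : seq A := pmap (fun l => l.2) c.

Lemma zip_padK u v : [/\ well_padded true true (zip_pad u v),
  proj1 (zip_pad u v) = u & proj2 (zip_pad u v) = v].
Proof.
elim: u v => [|a u IHu] [|b v] //=.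
- split; last 1 first.
  + by congr cons; elim: v => //= c v ->.
  + by elim: v.
  + by elim: v.
- split.
  + by elim: u {IHu}.
  + by congr cons; elim: u {IHu} => //= c u ->.
  + by elim: u {IHu}.
- case: (IHu v) => wp p1 p2.
  by rewrite /proj1 /proj2 /= -/(proj1 _) -/(proj2 _) p1 p2.
Qed.

Lemma take_zip_pad i u v : take i (zip_pad u v) = zip_pad (take i u) (take i v).
Proof.
elim: i u v => [|i IHi] [|a u] [|b v] //=.
- by rewrite map_take.
- by rewrite map_take.
- by rewrite IHi.
Qed.

Lemma well_paddedP b1 b2 c : (None, None) \notin c -> well_padded b1 b2 c ->
  c = zip_pad (proj1 c) (proj2 c).
Proof.
have pad1 b d : well_padded false b d -> proj1 d = [::].
  by elim: d b => [|[[a|] o] d IHd] b //= /andP[_ /IHd].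
have pad2 b d : well_padded b false d -> proj2 d = [::].
  elim: d b => [|[o [a|]] d IHd] b //=; first by rewrite andbF.
  by move=> /andP[_ /IHd].
elim: c b1 b2 => [|[oa ob] c IHc] b1 b2 //.
rewrite inE negb_or => /andP[l_ok no_c] /= /and3P[_ _].
case: oa ob l_ok => [a|] [b|] //= _;
  rewrite /proj1 /proj2 /= -/(proj1 _) -/(proj2 _).
- by move=> /IHc cE; congr cons; apply: cE.
- rewrite andbF => wp; rewrite (pad2 _ _ wp) /= -zip_pad0; congr cons.
  by rewrite -(pad2 _ _ wp); apply: IHc wp.
- rewrite andbF => wp; rewrite (pad1 _ _ wp) /=; congr cons.
  by have := IHc _ _ no_c wp; rewrite (pad1 _ _ wp).
Qed.

Lemma val_conv_zip (u v : words A) : map val (conv u v) = zip_pad u v.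
Proof. by rewrite val_conv zip_padE. Qed.

Variables (L : set (words A)) (R : seq A -> seq A -> Prop).
Variables (Q : finType) (dec : Q -> seq A -> seq A -> Prop).

(** A synchronous Myhill-Nerode criterion: a relation between words of a
    regular language is recognised by reading both words in parallel as soon
    as finitely many relations arise as the residuals of [R] at the pairs of
    prefixes of equal length. *)
Lemma regular_synchronous :
    regular [set seq_of_words w | w in L] ->
    (forall u v : words A, L u -> L v -> R u v -> forall i, exists q, 
       forall s t, R (take i u ++ s) (take i v ++ t) <-> dec q s t) ->
  regular [set c | exists u v, [/\ L u, L v, R u v & c = conv u v]].
Proof.
move=> [M LM] finR.
set LR := [set c | _].
have memLR c : LR c <-> [/\ well_padded true true (map val c),
    dfa_accept M (proj1 (map val c)), dfa_accept M (proj2 (map val c)) &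
    R (proj1 (map val c)) (proj2 (map val c))].
  have memM w : dfa_accept M w <-> exists2 u, L u & seq_of_words u = w.
    have := congr1 (fun D : set (seq A) => D w) LM => /= <-.
    by split=> [[u]|[u]]; exists u.
  split=> [[u [v [Lu Lv Ruv ->]]]|[wp /memM[u Lu uE] /memM[v Lv vE] Ruv]].
    rewrite val_conv_zip; case: (zip_padK u v) => -> -> ->.
    by split=> //; apply/memM; [exists u|exists v].
  exists u, v; rewrite uE vE; split=> //.
  apply: (inj_map val_inj); rewrite val_conv_zip uE vE.
  apply: well_paddedP wp.
  by apply/negP => /mapP[l _ lE]; have := valP l; rewrite -lE.
pose run q w := foldl (@dfa_step A M) q w.
(* A residual is determined by the padding flags, the states reached on both
   tracks, and the residual of [R]. *)
pose decLR (s : bool * bool * dfa_state M * dfa_state M * Q) :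
    set (seq (pad_letter A)) :=
  let: (b1, b2, q1, q2, q) := s in
  [set c | [/\ well_padded b1 b2 (map val c),
     dfa_final (run q1 (proj1 (map val c))), dfa_final (run q2 (proj2 (map val c)))
   & dec q (proj1 (map val c)) (proj2 (map val c))]].
apply: (@regular_residuals _ _ _ decLR) => p s.
move=> [u [v [Lu Lv Ruv psE]]].
have pE : map val p = zip_pad (take (size p) u) (take (size p) v).
  rewrite -take_zip_pad -val_conv_zip -psE map_cat take_cat size_map ltnn.
  by rewrite subnn take0 cats0.
case: (finR u v Lu Lv Ruv (size p)) => q qE.
have [wp p1 p2] := zip_padK (take (size p) u) (take (size p) v).
rewrite -pE in wp p1 p2.
exists (still1 (map val p), still2 (map val p),
  run (dfa_init M) (take (size p) u), run (dfa_init M) (take (size p) v), q).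
apply/funext => t; apply/propext; rewrite /residual /= memLR map_cat.
rewrite well_padded_cat /proj1 /proj2 !pmap_cat.
rewrite -/(proj1 _) -/(proj2 _) -/(proj1 _) -/(proj2 _).
rewrite p1 p2 wp /dfa_accept !foldl_cat /=.
by split=> -[? ? ? /qE ?].
Qed.

End Synchronous.

(** * Paced factorisations in a finitely generated subsemigroup *)

Section NumericalMonoid.

Variable E : nat -> Prop.
Hypotheses (E0 : E 0) (ED : forall a b, E a -> E b -> E (a + b)).

(** Take for [f] an element of a finite set that meets every residue class
    modulo [k] met by [E], in the manner of an Apery set. *)
Lemma apery k : 0 < k -> exists B, forall e, E e ->
  exists f t, [/\ f <= B, E f & e = f + k * t].
Proof.
move=> k_gt0.
suff [B HB] : exists B, forall e, e %% k < k -> E e ->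
    exists f t, [/\ f <= B, E f & e = f + k * t].
  by exists B => e; apply: HB; rewrite ltn_mod.
move: {2}k => r; elim: r => [|r [B HB]]; first by exists 0.
have [[e0 [Ee0 e0r]]|no_e0] := pselect (exists e0, E e0 /\ e0 %% k = r).
  exists (maxn B e0) => e; rewrite ltnS leq_eqVlt => /predU1P[er|/HB{}HB] Ee.
    have [e_le|e_gt] := leqP e e0.
      by exists e, 0; rewrite muln0 addn0; split=> //; rewrite leq_max e_le orbT.
    exists e0, ((e - e0) %/ k); split=> //; first by rewrite leq_max leqnn orbT.
    rewrite mulnC divnK ?subnKC //; first exact: ltnW.
    by rewrite -eqn_mod_dvd ?er ?e0r // ltnW.
  have [f [t [f_le Ef ->]]] := HB Ee.
  by exists f, t; rewrite leq_max f_le.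
exists B => e; rewrite ltnS leq_eqVlt => /predU1P[er|]; last exact: HB.
by move=> Ee; case: no_e0; exists e.
Qed.

(** When [E] is trivial there is no positive period; the last clause then
    forces [t = 0], so that no letter has to spell the empty word. *)
Lemma numerical_monoid : exists k B, E k /\ forall e, E e ->
  exists f t, [/\ f <= B, E f, e = f + k * t & 0 < t -> 0 < k].
Proof.
have [[k [k_gt0 Ek]]|no_k] := pselect (exists k, 0 < k /\ E k).
  have [B HB] := apery k_gt0; exists k, B; split=> // e /HB[f [t [? ? ?]]].
  by exists f, t.
exists 0, 0; split=> // -[|e] Ee; first by exists 0, 0.
by case: no_k; exists e.+1.
Qed.

Lemma closed_muln k t : E k -> E (k * t).
Proof. by move=> Ek; elim: t => [|t IHt]; rewrite ?muln0 // mulnS; apply: ED. Qed.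

End NumericalMonoid.

Section Decomposition.

Variables (m n : nat).
Hypothesis (lt_mn : m < n).

Local Notation nf := (nf m n).

Variable M : seq bool -> Prop.
Hypotheses (Mcat : forall u v, M u -> M v -> M (u ++ v)).

Definition M_or_nil (w : seq bool) : Prop := w = [::] \/ M w.

Lemma M_or_nil_cat u v : M_or_nil u -> M_or_nil v -> M_or_nil (u ++ v).
Proof.
by case=> [-> //|Mu] [->|Mv]; right; rewrite ?cats0 //; apply: Mcat.
Qed.

Lemma M_or_nil_catl u v : M_or_nil u -> M v -> M (u ++ v).
Proof. by case=> [-> //|Mu Mv]; apply: Mcat. Qed.

(** The finite stock of factors from which the blocks are assembled. *)
Definition syllable C N (b : seq bool) : Prop :=
  [/\ M b, size b <= C, 0 < deg b & deg b <= N].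

Variables (G : seq (seq bool)) (N : nat).
Hypotheses (MG : forall g, g \in G -> M g) (leGN : forall g, g \in G -> size g <= N).

(** Multiply by the generators one at a time on the right.  A power of [x] is
    absorbed into the final exponent.  Any other generator [g], of degree [d],
    first lets the multiples of [n^d] in the exponent of [x^k] pass to its
    right; what stays on its left is bounded and forms a syllable with [g]. *)
Lemma syllables : exists k C, M_or_nil (nseq k x) /\
  forall gs : seq (seq bool), {subset gs <= G} ->
  exists bs f t, [/\ forall b, b \in bs -> syllable C N b,
    M_or_nil (nseq f x), f <= C, 0 < t -> 0 < k &
    nf (flatten gs) = nf (flatten bs ++ nseq f x ++ nseq (k * t) x)].
Proof.
pose E e := M_or_nil (nseq e x).
have ED a b : E a -> E b -> E (a + b) by rewrite /E nseqD; apply: M_or_nil_cat.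
have E0 : E 0 by left.
have [k [B [Ek HB]]] := numerical_monoid E0.
pose C := B + k * n ^ N + N.
suff HG (gs : seq (seq bool)) : {subset gs <= G} ->
    exists bs f t, [/\ forall b, b \in bs -> syllable C N b,
      M_or_nil (nseq f x), f <= B, 0 < t -> 0 < k &
      nf (flatten gs) = nf (flatten bs ++ nseq f x ++ nseq (k * t) x)].
  exists k, C; split=> // gs /HG[bs [f [t [? ? f_le ? ?]]]].
  exists bs, f, t; split=> //.
  by apply: leq_trans f_le _; rewrite /C -addnA leq_addr.
elim/last_ind: gs => [|gs g IHgs] sub.
  by exists [::], 0, 0; rewrite muln0; split=> //; left.
have /IHgs[bs [f [t [bs_ok Ef f_le t_gt0 gsE]]]] : {subset gs <= G}.
  by move=> h h_in; apply: sub; rewrite mem_rcons inE h_in orbT.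
have g_in : g \in G by apply: sub; rewrite mem_rcons mem_head.
have Mg := MG g_in; have g_le := leGN g_in.
rewrite -cats1 flatten_cat /= cats0 (nf_catr _ gsE) -!catA.
have [/deg0P gE|g_deg] := posnP (deg g).
  have /HB[f' [t' [f'_le Ef' fE t'_gt0]]] : E (f + size g).
    by apply: ED => //; right; rewrite -gE.
  exists bs, f', (t' + t); split=> //.
  - by rewrite addn_gt0 => /orP[].
  - by rewrite gE cat_nseq_cat -!nseqD addnAC fE -addnA -mulnDr.
pose t0 := t %% n ^ deg g; pose q := t %/ n ^ deg g.
have n_gt0 : 0 < n by apply: leq_ltn_trans lt_mn.
have pow_gt0 : 0 < n ^ deg g by rewrite expn_gt0 n_gt0.
have t0_lt : t0 < n ^ deg g by rewrite ltn_mod.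
have pow_le : n ^ deg g <= n ^ N.
  by rewrite leq_pexp2l // (leq_trans (deg_size g)).
exists (rcons bs (nseq (f + k * t0) x ++ g)), 0, (m ^ deg g * q); split.
- move=> b; rewrite mem_rcons inE => /predU1P[->|/bs_ok//].
  split.
  + have Eft : E (f + k * t0).
      by apply: (ED _ _ Ef); exact: (@closed_muln E E0 ED k t0 Ek).
    exact: M_or_nil_catl.
  + have : k * t0 <= k * n ^ N by rewrite leq_mul2l; apply/orP; right; lia.
    by move=> kt0; rewrite size_cat size_nseq /C !leq_add.
  + by rewrite deg_cat deg_nseq.
  + by rewrite deg_cat deg_nseq (leq_trans (deg_size g)).
- by left.
- by [].
- rewrite muln_gt0 => /andP[_ q_gt0]; apply: t_gt0.
  by rewrite (leq_trans q_gt0) // leq_div.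
have tE : f + k * t = f + k * t0 + n ^ deg g * (k * q).
  by rewrite {1}(divn_eq t (n ^ deg g)) -/t0 -/q; nia.
rewrite flatten_rcons -!catA; apply: nf_catl => //.
rewrite cat_nseq_cat tE nseqD -catA; apply: nf_catl => //.
by rewrite nf_move // mulnCA.
Qed.

(** Greedy grouping: a block is closed as soon as it completes a multiple of
    [N]; each syllable has degree at most [N], so no multiple is skipped. *)
Lemma grouping C bs off r :
    (forall b, b \in bs -> syllable C N b) ->
    off + deg r < N -> M_or_nil r -> size r <= C * deg r ->
  exists ls r', [/\ r ++ flatten bs = flatten ls ++ r', paced N off ls,
    forall l, l \in ls -> M l /\ size l <= C * (2 * N), M_or_nil r' &
    size r' <= C * N].
Proof.
elim: bs off r => [|b bs IHbs] off r bs_ok r_deg Mr r_size.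
  exists [::], r; rewrite cats0; split=> //; nia.
have bs_ok' b' : b' \in bs -> syllable C N b'.
  by move=> b'_in; apply: bs_ok; rewrite inE b'_in orbT.
have [Mb b_size b_gt0 b_deg] := bs_ok b (mem_head _ _).
have rb_size : size (r ++ b) <= C * deg (r ++ b).
  by rewrite size_cat deg_cat mulnDr leq_add //; nia.
have Mrb : M (r ++ b) by apply: M_or_nil_catl.
have rb_deg := deg_cat r b.
have [rb_lt|rb_ge] := ltnP (off + deg (r ++ b)) N.
  have [ls [r' [E' ls_ok Mls Mr' r'_size]]] :=
    IHbs off _ bs_ok' rb_lt (or_intror Mrb) rb_size.
  by exists ls, r'; rewrite /= catA.
have off_lt : off + deg (r ++ b) - N + deg [::] < N by rewrite addn0; lia.
have [ls [r' [E' ls_ok Mls Mr' r'_size]]] :=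
  IHbs _ [::] bs_ok' off_lt (or_introl erefl) (leq0n _).
exists ((r ++ b) :: ls), r'; split=> //.
- by rewrite /= catA -[flatten bs]cat0s E' catA.
- by rewrite /= ls_ok andbT; lia.
- move=> l; rewrite inE => /predU1P[->|/Mls//]; split=> //.
  by apply: leq_trans rb_size _; rewrite leq_mul2l; apply/orP; right; lia.
Qed.

Lemma paced_decomposition : 0 < N -> exists k K, [/\ k <= K, N <= K &
  forall gs : seq (seq bool), {subset gs <= G} ->
  exists ls rs t, [/\ paced N 0 ls, size rs <= 1,
    forall l, l \in ls ++ rs ++ tail k t -> M l /\ size l <= K &
    nf (flatten gs) = nf (flatten (ls ++ rs ++ tail k t))]].
Proof.
move=> N_gt0; have [k [C [Mk HG]]] := syllables.
exists k, (C * (2 * N) + C * N + C + N + k); split; [lia|lia|].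
move=> gs /HG[bs [f [t [bs_ok Mf f_le t_gt0 ->]]]].
have [ls [r [rE ls_ok Mls Mr r_size]]] :=
  @grouping C bs 0 [::] bs_ok N_gt0 (or_introl erefl) (leq0n _).
pose rf := r ++ nseq f x.
exists ls, (if nilp rf then [::] else [:: rf]), t; split=> //.
- by case: ifP.
- move=> l; rewrite !mem_cat => /or3P[/Mls[Ml l_size]|l_r|].
  + by split=> //; lia.
  + have -> : l = rf by move: l_r; case: ifP => // _; rewrite inE => /eqP.
    have [rf0|Mrf] := M_or_nil_cat Mr Mf; first by move: l_r; rewrite /rf rf0.
    split; first exact: Mrf.
    by rewrite /rf size_cat size_nseq; apply: leq_trans (leq_add r_size f_le) _; nia.
  + rewrite mem_nseq => /andP[/t_gt0 k_gt0 /eqP ->]; rewrite size_nseq.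
    split; last lia.
    by case: Mk => // Mk; case: k k_gt0 Mk {HG t_gt0}.
have rfE : flatten (if nilp rf then [::] else [:: rf]) = rf.
  by case: ifP => [/nilP->|_] //=; rewrite cats0.
by rewrite !flatten_cat rfE flatten_tail -[flatten bs]cat0s rE /rf -!catA.
Qed.

End Decomposition.

(** * The language of paced words *)

Section PacedLanguage.

Variables (A : finType) (tag : A -> option bool) (wd : A -> seq bool).
Variables (k N : nat).

Definition tail_letters (w : seq A) : bool :=
  all (fun a => (tag a == Some true) && (wd a == nseq k x)) w.

(** The tags [None], [Some false], [Some true] announce a block, the remainder
    and the tail; they make the decomposition of a word deterministic. *)
Fixpoint shaped (off : nat) (w : seq A) : bool :=
  if w is a :: w' then
    match tag a with
    | None => (N <= off + deg (wd a) < 2 * N) && shaped (off + deg (wd a) - N) w'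
    | Some false => tail_letters w'
    | Some true => (wd a == nseq k x) && tail_letters w'
    end
  else true.

Lemma tail_lettersE w : tail_letters w -> map wd w = tail k (size w).
Proof. by elim: w => [|a w IHw] //= /andP[/andP[_ /eqP ->] /IHw ->]. Qed.

Lemma shaped_split off w : shaped off w -> exists ls rs t,
  [/\ map wd w = ls ++ rs ++ tail k t, paced N off ls & size rs <= 1].
Proof.
elim: w off => [|a w IHw] off /=; first by exists [::], [::], 0.
case: (tag a) => [[/andP[/eqP -> /tail_lettersE ->]|/tail_lettersE ->]|].
- by exists [::], [::], (size w).+1.
- by exists [::], [:: wd a], (size w).
case/andP=> a_deg /IHw[ls [rs [t [-> ls_ok rs_le]]]].
by exists (wd a :: ls), rs, t; rewrite /= a_deg.
Qed.

Lemma shaped_join (ok : seq bool -> Prop) off ls rs t :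
    (forall o w, ok w -> exists a, tag a = o /\ wd a = w) ->
    paced N off ls -> size rs <= 1 ->
    (forall l, l \in ls ++ rs ++ tail k t -> ok l) ->
  exists w, shaped off w /\ map wd w = ls ++ rs ++ tail k t.
Proof.
move=> enc; elim: ls off => [|l ls IHls] off /=.
  move=> _ rs_le okl.
  have [z [z_tail zE]] : exists z, tail_letters z /\ map wd z = tail k t.
    elim: t {rs_le} okl => [|t IHt] okl; first by exists [::].
    have [|z [z_tail zE]] := IHt.
      move=> l l_in; apply: okl; move: l_in; rewrite !mem_cat inE.
      by case/orP=> ->; rewrite ?orbT.
    have [|a [aT aE]] := enc (Some true) (nseq k x).
      by apply: okl; rewrite mem_cat inE eqxx orbT.
    by exists (a :: z); rewrite /= aT aE !eqxx zE.
  case: rs rs_le okl => [|r [|//]] _ okl /=.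
    exists z; split=> //; case: z z_tail {zE} => [|a z] //=.
    by case/andP=> /andP[/eqP -> ->] ->.
  have [|a [aT aE]] := enc (Some false) r; first by apply: okl; rewrite mem_head.
  by exists (a :: z); rewrite /= aT aE zE.
case/andP=> l_deg /IHls{}IHls /IHls{}IHls okl.
have [|w [w_ok wE]] := IHls.
  by move=> h h_in; apply: okl; rewrite inE h_in orbT.
have [|a [aT aE]] := enc None l; first by apply: okl; rewrite mem_head.
by exists (a :: w); rewrite /= aT aE l_deg wE.
Qed.

Definition paced_language : set (words A) := [set w | shaped 0 w].

Lemma tail_residual p s : tail_letters (p ++ s) ->
  forall t, tail_letters (p ++ t) = tail_letters t.
Proof.
by rewrite /tail_letters all_cat => /andP[p_ok _] t; rewrite all_cat p_ok.
Qed.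

(** Reading a prefix leaves an excess [o < N] or enters the tail, so that
    finitely many residuals occur. *)
Lemma shaped_residual off p s : off < N -> shaped off (p ++ s) ->
  (exists o : 'I_N, forall t, shaped off (p ++ t) = shaped o t) \/
  (forall t, shaped off (p ++ t) = tail_letters t).
Proof.
elim: p off => [|a p IHp] off off_lt /=.
  by move=> _; left; exists (Ordinal off_lt).
case: (tag a) => [[/andP[-> /tail_residual p_ok]|/tail_residual p_ok]|].
- by right.
- by right.
case/andP=> a_deg; rewrite a_deg; apply: IHp; lia.
Qed.

Hypothesis N_gt0 : 0 < N.

Lemma regular_paced : regular [set seq_of_words w | w in paced_language].
Proof.
have memL w : [set seq_of_words w | w in paced_language] w <->
    w <> [::] /\ shaped 0 w.
  split=> [[u u_ok <-] //|[]]; case: w => [|a w] // _ w_ok.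
  by exists (a, w).
pose dec (o : option (option 'I_N)) : set (seq A) :=
  match o with
  | None => [set w | w <> [::] /\ shaped 0 w]
  | Some None => [set w | tail_letters w]
  | Some (Some o) => [set w | shaped o w]
  end.
apply: (@regular_residuals _ _ _ dec) => p s /memL[_ ps_ok].
case: p ps_ok => [|a p] ps_ok.
  by exists None; apply/funext => t; apply/propext; exact: memL.
have [[o oE]|tE] := shaped_residual N_gt0 ps_ok.
  exists (Some (Some o)); apply/funext => t; apply/propext.
  by rewrite /residual /= -oE; split=> [/memL[]//|?]; apply/memL.
exists (Some None); apply/funext => t; apply/propext.
by rewrite /residual /= -tE; split=> [/memL[]//|?]; apply/memL.
Qed.

Variables (m n K : nat).
Hypotheses (lt_mn : m < n) (k_le : k <= K) (wd_le : forall a, size (wd a) <= K).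

Local Notation nf := (nf m n).
Local Notation spell u := (flatten (map wd u)).

(** By [fellow_traveller] and [close_residual], the relations between the
    continuations of [u] and [v] are indexed by pairs of words of length at
    most [C]. *)
Lemma regular_multiplier w : size w <= K ->
  regular [set c | exists u v : words A, [/\ paced_language u, paced_language v,
    nf (w ++ spell u) = nf (spell v) & c = conv u v]].
Proof.
move=> w_le; pose C := fellow_bound n N K.
pose dec (DD : C.-bseq bool * C.-bseq bool) (s t : seq A) : Prop :=
  nf (DD.1 ++ spell s) = nf (DD.2 ++ spell t).
pose R (u v : seq A) := nf (w ++ spell u) = nf (spell v).
apply: (@regular_synchronous _ _ R _ dec).
  exact: regular_paced.
move=> u v u_ok v_ok uv i.
have [ls [rs [t [uE ls_ok rs_le]]]] := shaped_split u_ok.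
have [ls' [rs' [t' [vE ls'_ok rs'_le]]]] := shaped_split v_ok.
have all_le z : all (fun l => size l <= K) (map wd z).
  by apply/allP => l /mapP[a _ ->].
have : close m n C (w ++ spell (take i u)) (spell (take i v)).
  rewrite !map_take.
  exact: (fellow_traveller lt_mn i N_gt0 k_le w_le (all_le u) (all_le v) uE vE).
move=> /(close_residual lt_mn)[D [D' [D_le D'_le DE]]].
exists (Bseq D_le, Bseq D'_le) => s z.
by rewrite /R !map_cat !flatten_cat catA; apply: DE.
Qed.

End PacedLanguage.

(** * Automatic structure of a subsemigroup *)

Section Subsemigroup.

Variables (m n : nat).
Hypothesis (lt_mn : m < n).

Local Notation nf := (nf m n).

Variables (P : pred (baumslag_solitar m n)) (T : subSemigroupType P).

Definition bs_pi (w : words bool) : baumslag_solitar m n :=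
  (\pi_(presented (bs_rel m n)) w)%qT.

Definition spells (w : seq bool) (t : T) : Prop :=
  exists2 w' : words bool, w = w' & \val t = bs_pi w'.

Lemma spells_mul u v s t : spells u s -> spells v t -> spells (u ++ v) (s * t)%g.
Proof.
case=> u' -> sE [v' -> tE]; exists (words_mul u' v') => //.
by rewrite valM sE tE; apply: presented_mulE.
Qed.

(** The bridge from equality in [T] to normal forms of words. *)
Lemma spells_nf u v s t : spells u s -> spells v t -> s = t <-> nf u = nf v.
Proof.
case=> u' -> sE [v' -> tE].
split=> [st|uv]; first by apply/nf_pres/presented_eqP => //; rewrite -[LHS]sE st tE.
by apply: val_inj; rewrite /= sE tE; apply/presented_eqP/(nf_pres lt_mn).
Qed.

Lemma spells_nil t : ~ spells [::] t.
Proof. by case. Qed.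

Definition spelling (t : T) : seq bool :=
  (repr (\val t : presented (bs_rel m n)))%qT.

Lemma spellingP t : spells (spelling t) t.
Proof.
exists (repr (\val t : presented (bs_rel m n)))%qT => //.
by rewrite /bs_pi reprK.
Qed.

Definition spelled (w : seq bool) : Prop := exists t, spells w t.

Lemma nf_nil w : nf w = nf [::] -> w = [::].
Proof. by move=> /(scong_nf lt_mn)[//|[u [v [_ /esym]]]]. Qed.

Lemma spelled_cat u v : spelled u -> spelled v -> spelled (u ++ v).
Proof. by move=> [s us] [t vt]; exists (s * t)%g; apply: spells_mul. Qed.

Section Letters.

Variable K : nat.

Definition short_word : finType := {b : K.-bseq bool | `[< spelled b >]}.
Definition letter : finType := (option bool * short_word)%type.

Definition letter_word (a : letter) : seq bool := val (val a.2).

Definition letter_value (a : letter) : T := projT1 (cid (asboolW (valP a.2))).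

Lemma letter_spells a : spells (letter_word a) (letter_value a).
Proof. exact: projT2 (cid (asboolW (valP a.2))). Qed.

Lemma size_letter a : size (letter_word a) <= K.
Proof. exact: size_bseq. Qed.

Lemma letter_ex o w : spelled w /\ size w <= K ->
  exists a : letter, a.1 = o /\ letter_word a = w.
Proof.
move=> [w_sp w_le]; have b_sp : `[< spelled (Bseq w_le) >] by apply/asboolP.
by exists (o, exist _ (Bseq w_le) b_sp).
Qed.

Lemma eval_spells (w : words letter) :
  spells (flatten (map letter_word w)) (eval letter_value w).
Proof.
rewrite /eval /seq_of_words; case: w => a w /=.
elim/last_ind: w => [|w b IHw]; first by rewrite /= cats0; apply: letter_spells.
rewrite -cats1 foldl_cat map_cat flatten_cat catA /= cats0.
by apply: spells_mul => //; apply: letter_spells.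
Qed.

End Letters.

Lemma left_automatic_subsemigroup : finitely_generated T -> left_automatic T.
Proof.
case=> X /finite_seqP[s XE] genX.
pose G := map spelling s.
pose N := (\max_(g <- G) size g).+1.
have leGN g : g \in G -> size g <= N.
  by move=> g_in; apply: leqW; rewrite (leq_bigmax_seq (F := size)).
have MG g : g \in G -> spelled g.
  by case/mapP=> t _ ->; exists t; apply: spellingP.
have [k [K [k_le N_le HG]]] :=
  paced_decomposition lt_mn spelled_cat MG leGN (ltn0Sn _).
have genG t : exists2 gs : seq (seq bool), {subset gs <= G} & spells (flatten gs) t.
  have : smallest (@mul_closed T) X t by rewrite genX.
  apply: (smallest_sub (X :=
    [set t | exists2 gs : seq (seq bool), {subset gs <= G} & spells (flatten gs) t])).
    move=> a b [gs gs_G a_sp] [hs hs_G b_sp]; exists (gs ++ hs).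
      by move=> g; rewrite mem_cat => /orP[/gs_G|/hs_G].
    by rewrite flatten_cat; apply: spells_mul.
  rewrite XE => a a_s; exists [:: spelling a].
    by move=> g; rewrite inE => /eqP ->; apply: map_f.
  by rewrite /= cats0; apply: spellingP.
pose phi : letter K -> T := @letter_value K.
pose L := paced_language (fun a : letter K => a.1) (@letter_word K) k N.
exists (letter K), phi, L; split.
- apply/seteqP; split=> // t _.
  have : smallest (@mul_closed T) X t by rewrite genX.
  apply: sub_smallest2r => [a b aS bS D [DM DX]|].
    exact: DM (aS D (conj DM DX)) (bS D (conj DM DX)).
  rewrite XE => a a_s.
  have [|l [_ lE]] := @letter_ex K None (spelling a).
    split; first by exists a; apply: spellingP.
    by apply: leq_trans N_le; apply: leGN; apply: map_f.
  exists l => //; apply/(spells_nf (letter_spells l) (spellingP a)).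
  by rewrite lE.
- exact: regular_paced.
- apply/seteqP; split=> // t _.
  have [gs gs_G gs_t] := genG t.
  have [ls [rs [z [ls_ok rs_le l_ok gsE]]]] := HG gs gs_G.
  have [w [w_ok wE]] := shaped_join (@letter_ex K) ls_ok rs_le l_ok.
  rewrite -wE in gsE.
  case: w w_ok wE gsE => [|a w] w_ok wE gsE.
    by case: (@spells_nil t); rewrite -(nf_nil gsE).
  exists (a, w) => //.
  by apply/(spells_nf (eval_spells _) gs_t).
- move=> o.
  pose w := if o is Some a then letter_word a else [::].
  have w_le : size w <= K by rewrite /w; case: (o) => [a|] //; apply: size_letter.
  have := @regular_multiplier _ (fun a : letter K => a.1) (@letter_word K)
    k N (ltn0Sn _) m n K lt_mn k_le (@size_letter K) w w_le.
  congr regular; apply/funext => c; apply/propext.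
  have evE u v : eval phi (opt_cons o u) = eval phi v <->
      nf (w ++ flatten (map (@letter_word K) u)) =
      nf (flatten (map (@letter_word K) v)).
    have := spells_nf (eval_spells (opt_cons o u)) (eval_spells v).
    by rewrite /w; case: (o).
  by split=> -[u [v [Lu Lv /evE uv cE]]]; exists u, v.
Qed.

End Subsemigroup.

Theorem theorem5p1 (m n : nat) (m_gt0 : 0 < m) (lt_mn : m < n)
    (P : pred (baumslag_solitar m n)) (T : subSemigroupType P) :
  finitely_generated T -> left_automatic T.
Proof. exact: left_automatic_subsemigroup. Qed.
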